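(* For every $n\ge 1$, the monoid $\mathcal{DORP}_n$ is $\mathcal{R}$-trivial, that is, Green's relation $\mathcal{R}$ on $\mathcal{DORP}_n$ is the equality relation.
   Context: Let $[n]=\{1,\dots,n\}$ with its usual order. A partial transformation of $[n]$ is a function $\rho$ whose domain $\mathrm{Dom}\,\rho$ and image $\mathrm{Im}\,\rho$ are subsets of $[n]$ (the empty map is allowed). Maps are written on the right and composed left to right: $x(\rho\sigma)=(x\rho)\sigma$. $\rho$ is isotone if $x\le y$ implies $x\rho\le y\rho$ for all $x,y\in\mathrm{Dom}\,\rho$; antitone if $x\le y$ implies $x\rho\ge y\rho$; monotone if isotone or antitone; decreasing if $x\rho\le x$ for all $x\in\mathrm{Dom}\,\rho$. $\mathcal{DORP}_n$ is the monoid, under composition, of all monotone and decreasing partial transformations of $[n]$. Green's relation $\mathcal{R}$ on a semigroup $S$: $g\,\mathcal{R}\,h$ iff $gS^1=hS^1$. *)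

(* Defs.v *)
From HB Require Import structures.
From mathcomp Require Import all_boot.

Set Implicit Arguments.
Unset Strict Implicit.
Unset Printing Implicit Defensive.

Local Open Scope group_scope.

Section GreenR.

Variable S : semigroupType.

(* The set g S^1 = {g} U gS, as a subset of S; whether S^1 adjoins an identity
   always or only when S has none, this set is the same. *)
Definition principal_right_ideal (g x : S) : Prop :=
  x = g \/ exists s : S, x = g * s.

Definition greenR (g h : S) : Prop :=
  forall x : S, principal_right_ideal g x <-> principal_right_ideal h x.

Definition R_trivial : Prop := forall g h : S, greenR g h <-> g = h.

End GreenR.

(* Partial transformations of a chain with n elements: 'I_n, i.e. {0, ..., n-1},
   stands for {1, ..., n}, and r x = None means that x is not in Dom r. *)
Definition ptrans (n : nat) : Type := {ffun 'I_n -> option 'I_n}.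

HB.instance Definition _ n := Finite.copy (ptrans n) {ffun 'I_n -> option 'I_n}.

Section PartialTransformations.

Variable n : nat.
Implicit Types r s : ptrans n.

(* Maps act on the right, so in the product r * s the map r is applied first. *)
Definition pt_comp r s : ptrans n := [ffun x => obind s (r x)].

Definition pt_id : ptrans n := [ffun x => Some x].

Lemma pt_compA : associative pt_comp.
Proof.
by move=> r s t; apply/ffunP => x; rewrite !ffunE; case: (r x) => //= y;
  rewrite ffunE.
Qed.

Lemma pt_comp1r : left_id pt_id pt_comp.
Proof. by move=> r; apply/ffunP => x; rewrite !ffunE. Qed.

Lemma pt_compr1 : right_id pt_id pt_comp.
Proof.
by move=> r; apply/ffunP => x; rewrite ffunE; case: (r x) => //= y;
  rewrite ffunE.
Qed.

HB.instance Definition _ := isSemigroup.Build (ptrans n) pt_compA.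
HB.instance Definition _ :=
  Magma_isUMagma.Build (ptrans n) pt_comp1r pt_compr1.

(* In these predicates a and b range over the values of r at x and y. *)
Definition isotone r : bool :=
  [forall x, forall y, forall a, forall b,
     [&& r x == Some a, r y == Some b & x <= y] ==> (a <= b)].

Definition antitone r : bool :=
  [forall x, forall y, forall a, forall b,
     [&& r x == Some a, r y == Some b & x <= y] ==> (b <= a)].

Definition monotone r : bool := isotone r || antitone r.

Definition decreasing r : bool :=
  [forall x, forall a, (r x == Some a) ==> (a <= x)].

Definition dorp_pred : {pred ptrans n} :=
  [pred r | monotone r && decreasing r].

Lemma isotoneP r :
  reflect (forall x y a b : 'I_n,
             r x = Some a -> r y = Some b -> x <= y -> a <= b) (isotone r).
Proof.
apply: (iffP idP) => [H x y a b /eqP rx /eqP ry xy|H].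
  by move/forallP/(_ x)/forallP/(_ y)/forallP/(_ a)/forallP/(_ b): H;
     rewrite rx ry xy.
apply/forallP => x; apply/forallP => y; apply/forallP => a; apply/forallP => b.
by apply/implyP => /and3P[/eqP rx /eqP ry]; apply: H.
Qed.

Lemma antitoneP r :
  reflect (forall x y a b : 'I_n,
             r x = Some a -> r y = Some b -> x <= y -> b <= a) (antitone r).
Proof.
apply: (iffP idP) => [H x y a b /eqP rx /eqP ry xy|H].
  by move/forallP/(_ x)/forallP/(_ y)/forallP/(_ a)/forallP/(_ b): H;
     rewrite rx ry xy.
apply/forallP => x; apply/forallP => y; apply/forallP => a; apply/forallP => b.
by apply/implyP => /and3P[/eqP rx /eqP ry]; apply: H.
Qed.

Lemma decreasingP r :
  reflect (forall x a : 'I_n, r x = Some a -> a <= x) (decreasing r).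
Proof.
apply: (iffP idP) => [H x a /eqP rx|H].
  by move/forallP/(_ x)/forallP/(_ a): H; rewrite rx.
by apply/forallP => x; apply/forallP => a; apply/implyP => /eqP; apply: H.
Qed.

Lemma pt_mulP r s x c :
  (r * s) x = Some c -> exists2 b, r x = Some b & s b = Some c.
Proof. by rewrite ffunE; case: (r x) => //= b; exists b. Qed.

Lemma dorp_umagma_closed : umagma_closed dorp_pred.
Proof.
split.
  rewrite inE; apply/andP; split.
    by apply/orP; left; apply/isotoneP => x y a b; rewrite !ffunE => -[<-] [<-].
  by apply/decreasingP => x a; rewrite ffunE => -[<-].
move=> r s; rewrite !inE => /andP[mr /decreasingP dr] /andP[ms /decreasingP ds].
apply/andP; split; last first.
  apply/decreasingP => x c /pt_mulP[b rx sb].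
  by apply: leq_trans (dr _ _ rx); apply: ds.
case/orP: mr => [/isotoneP|/antitoneP] Hr;
  case/orP: ms => [/isotoneP|/antitoneP] Hs; apply/orP.
- left; apply/isotoneP => x y a b /pt_mulP[u xu ua] /pt_mulP[v yv vb] xy.
  by apply: Hs ua vb _; apply: Hr xu yv xy.
- right; apply/antitoneP => x y a b /pt_mulP[u xu ua] /pt_mulP[v yv vb] xy.
  by apply: Hs ua vb _; apply: Hr xu yv xy.
- right; apply/antitoneP => x y a b /pt_mulP[u xu ua] /pt_mulP[v yv vb] xy.
  by apply: Hs vb ua _; apply: Hr xu yv xy.
- left; apply/isotoneP => x y a b /pt_mulP[u xu ua] /pt_mulP[v yv vb] xy.
  by apply: Hs vb ua _; apply: Hr xu yv xy.
Qed.

Record DORP : Type :=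
  MkDORP { dorp_val : ptrans n; _ : dorp_val \in dorp_pred }.

HB.instance Definition _ := [isSub for dorp_val].
HB.instance Definition _ := [Finite of DORP by <:].
HB.instance Definition _ :=
  SubChoice_isSubMonoid.Build (ptrans n) dorp_pred DORP dorp_umagma_closed.

Lemma DORP_mulE (g h : DORP) (x : 'I_n) :
  dorp_val (g * h) x = obind (dorp_val h) (dorp_val g x).
Proof. by rewrite /= ffunE. Qed.

End PartialTransformations.

(* Main.v *)
(* Right multiplication by a decreasing map shrinks the domain and lowers the
   values pointwise; two maps lying in each other's principal right ideal
   therefore have the same domain and the same values. *)
Require Import Defs.
From mathcomp Require Import all_boot.

Lemma principal_right_ideal_le (n : nat) (g h : DORP n) (x b : 'I_n) :
  principal_right_ideal g h -> dorp_val h x = Some b ->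
  exists2 a : 'I_n, dorp_val g x = Some a & b <= a.
Proof.
case=> [-> gx|[s ->]]; first by exists b.
rewrite DORP_mulE; case gx: (dorp_val g x) => [a|] //= sa; exists a => //.
(* Here [s] sends [a] to [b], and membership in [DORP n] makes [s] decreasing. *)
have := valP s; rewrite inE => /andP[_ /decreasingP]; exact.
Qed.

Theorem theorem2p2 (n : nat) (hn : 1 <= n) : R_trivial (DORP n).
Proof.
move=> g h; split=> [gRh|-> //].
(* Each element lies in its own ideal, hence in the other one. *)
have gh : principal_right_ideal g h by apply/gRh; left.
have hg : principal_right_ideal h g by apply/gRh; left.
apply/val_inj/ffunP => x /=.
case hx: (dorp_val h x) => [b|].
  have [a gx le_ba] := principal_right_ideal_le _ _ _ _ _ gh hx.
  (* Going back from [g] to [h] gives a value [c] of [h] at [x] with [a <= c]; since [c] is [b],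
     antisymmetry forces [a = b]. *)
  have [c] := principal_right_ideal_le _ _ _ _ _ hg gx.
  rewrite hx gx => -[<-] le_ab; congr Some; apply/val_inj/eqP.
  by rewrite eqn_leq le_ab.
(* Outside the domain of [h], a value of [g] at [x] would force one of [h]. *)
case gx: (dorp_val g x) => [a|] //.
by have [c] := principal_right_ideal_le _ _ _ _ _ hg gx; rewrite hx.
Qed.
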